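(* Let $U_1,U_2,U_3$ be finite-dimensional complex vector spaces with $\dim U_1 = r - 1$, and let $T \in U_1 \otimes U_2 \otimes U_3$ be a concise tensor such that $\langle r \rangle$ partially degenerates to $T$ and $\langle r \rangle$ does not restrict to $T$. Then, for some $q$ with $3 \leq q \leq r$, the tensor $T$ decomposes as $$T = S_q + X_{r-q},$$ where $S_q, X_{r-q}\in U_1\otimes U_2\otimes U_3$ are such that $\operatorname{Str}_{q}$ restricts to $S_q$ and $\langle r - q \rangle$ restricts to $X_{r-q}$.
   Context: The unit tensor is $\langle r \rangle = \sum_{i=1}^r e_i\otimes e_i\otimes e_i\in\mathbb{C}^r\otimes\mathbb{C}^r\otimes\mathbb{C}^r$ (with $\langle 0\rangle = 0$). Strassen's tensor is $\operatorname{Str}_q = \sum_{i = 1}^{q-1} (e_{i} \otimes e_i \otimes e_q + e_i \otimes e_q \otimes e_i) \in \mathbb{C}^{q-1} \otimes \mathbb{C}^{q} \otimes \mathbb{C}^{q}$. For tensors $T \in U_1 \otimes U_2 \otimes U_3$ and $S \in V_1\otimes V_2\otimes V_3$ (finite-dimensional complex vector spaces): - $T$ restricts to $S$ if there are linear maps $A_i: U_i\to V_i$ ($i=1,2,3$) with $S=(A_1\otimes A_2\otimes A_3)T$. - $T$ partially degenerates to $S$ if there are a linear map $A_1:U_1\to V_1$ (constant) and linear maps $A_2(\epsilon):U_2\to V_2$, $A_3(\epsilon):U_3\to V_3$ with entries in $\mathbb{C}[\epsilon]$, natural numbers $d,e\ge 0$ and tensors $S_1,\dots,S_e \in V_1\otimes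 V_2\otimes V_3$ such that $(A_1\otimes A_2(\epsilon)\otimes A_3(\epsilon))T=\epsilon^d S+\epsilon^{d+1}S_1+\dots+\epsilon^{d+e}S_e$. A tensor $T\in U_1\otimes U_2\otimes U_3$ is concise if its three flattening maps $U_1^*\to U_2\otimes U_3$, $U_2^*\to U_1\otimes U_3$, $U_3^*\to U_1\otimes U_2$ are injective. *)

(* Defs.v *)
From HB Require Import structures.
From mathcomp Require Import all_boot all_order all_algebra.
From mathcomp Require Import reals.
From mathcomp.real_closed Require Export complex.

Set Implicit Arguments.
Unset Strict Implicit.
Unset Printing Implicit Defensive.

Import GRing.Theory.
Local Open Scope ring_scope.

(* Vector spaces carry a fixed basis: K^a (x) K^b (x) K^c is the space of
   a * b * c arrays of coefficients.  K is either the base field or its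
   polynomial ring. *)
Notation tensor K a b c := {ffun 'I_a * 'I_b * 'I_c -> K}.

Definition pure_tensor (K : comNzRingType) (a b c : nat)
    (x : 'rV[K]_a) (y : 'rV[K]_b) (z : 'rV[K]_c) : tensor K a b c :=
  [ffun t => x 0 t.1.1 * y 0 t.1.2 * z 0 t.2].

(* Indices start at 0, so the e_i of the usual 1-based convention is
   [basis_vec K n i.-1]. *)
Definition basis_vec (K : comNzRingType) (n k : nat) : 'rV[K]_n :=
  \row_(j < n) (j == k :> nat)%:R.

Definition unit_tensor (K : comNzRingType) (r : nat) : tensor K r r r :=
  \sum_(i < r)
    pure_tensor (basis_vec K r i) (basis_vec K r i) (basis_vec K r i).

(* Meaningful for q > 0 only. *)
Definition strassen_tensor (K : comNzRingType) (q : nat) :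
    tensor K q.-1 q q :=
  \sum_(i < q.-1)
    (pure_tensor (basis_vec K q.-1 i) (basis_vec K q i) (basis_vec K q q.-1) +
     pure_tensor (basis_vec K q.-1 i) (basis_vec K q q.-1) (basis_vec K q i)).

(* (A1 (x) A2 (x) A3) T, the matrices acting on column vectors. *)
Definition tensor_map (K : comNzRingType) (a b c a' b' c' : nat)
    (A1 : 'M[K]_(a', a)) (A2 : 'M[K]_(b', b)) (A3 : 'M[K]_(c', c))
    (T : tensor K a b c) : tensor K a' b' c' :=
  [ffun t => \sum_(i < a) \sum_(j < b) \sum_(k < c)
     A1 t.1.1 i * A2 t.1.2 j * A3 t.2 k * T (i, j, k)].

Definition restricts (K : comNzRingType) (a b c a' b' c' : nat)
    (T : tensor K a b c) (S : tensor K a' b' c') : Prop :=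
  exists (A1 : 'M[K]_(a', a)) (A2 : 'M[K]_(b', b)) (A3 : 'M[K]_(c', c)),
    S = tensor_map A1 A2 A3 T.

Definition tensorC (K : comNzRingType) (a b c : nat) (T : tensor K a b c) :
    tensor {poly K} a b c :=
  [ffun t => (T t)%:P].

(* The indeterminate 'X plays the role of epsilon; [S_ k] is the coefficient
   of epsilon ^ (d + k + 1). *)
Definition partially_degenerates (K : comNzRingType) (a b c a' b' c' : nat)
    (T : tensor K a b c) (S : tensor K a' b' c') : Prop :=
  exists (A1 : 'M[K]_(a', a))
         (A2 : 'M[{poly K}]_(b', b)) (A3 : 'M[{poly K}]_(c', c))
         (d e : nat) (S_ : 'I_e -> tensor K a' b' c'),
    tensor_map (map_mx polyC A1) A2 A3 (tensorC T) =
    [ffun t => 'X^d * tensorC S t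
               + \sum_(k < e) 'X^(d + k.+1) * tensorC (S_ k) t].

(* Linear forms are given by their coordinates in the dual basis, and elements
   of a twofold tensor product by their matrix of coefficients. *)
Definition flattening1 (K : comNzRingType) (a b c : nat) (T : tensor K a b c)
    (f : 'rV[K]_a) : 'M[K]_(b, c) :=
  \matrix_(j, k) \sum_(i < a) f 0 i * T (i, j, k).

Definition flattening2 (K : comNzRingType) (a b c : nat) (T : tensor K a b c)
    (f : 'rV[K]_b) : 'M[K]_(a, c) :=
  \matrix_(i, k) \sum_(j < b) f 0 j * T (i, j, k).

Definition flattening3 (K : comNzRingType) (a b c : nat) (T : tensor K a b c)
    (f : 'rV[K]_c) : 'M[K]_(a, b) :=
  \matrix_(i, j) \sum_(k < c) f 0 k * T (i, j, k).

Definition concise (K : comNzRingType) (a b c : nat) (T : tensor K a b c) :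
    Prop :=
  [/\ injective (flattening1 T), injective (flattening2 T)
    & injective (flattening3 T)].

(* Main.v *)
Require Import Defs.
From HB Require Import structures.
From mathcomp Require Import all_boot all_order all_algebra ring.
From mathcomp Require Import reals.
From mathcomp.real_closed Require Import complex.

Set Implicit Arguments.
Unset Strict Implicit.
Unset Printing Implicit Defensive.

Import GRing.Theory.
Local Open Scope ring_scope.

(** The degeneration gives, with [r = a + 1],
    [sum_l a_l (x) b_l(eps) (x) c_l(eps) = eps^d T + O(eps^(d+1))], where the
    [a_l] are constant. They span the first factor because [T] is concise
    there, so they satisfy exactly one linear relation up to scaling, and all
    but one of them, [a_0] say, form a basis
    ([partially_degenerates_slices]). Expanding [T = sum_l a_l (x) T_l] in this
    basis gives, for scalars [mu_l],
      [b_l (x) c_l - mu_l b_0 (x) c_0 = eps^d T_l + O(eps^(d+1))].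

    If [mu_l = 0], then [T_l] is a leading term of matrices of rank at most
    one, so it has rank at most one itself ([leading_outer_product]). For the
    other [l], compare [d] with the order [s] at which [b_0 (x) c_0] vanishes at
    [eps = 0].
    - If [s >= d], every product [b_l (x) c_l] is divisible by [eps^d] as well,
      and dividing turns the degeneration into a restriction of the unit
      tensor, contrary to hypothesis.
    - If [s < d], the leading term of [b_0 (x) c_0] is some nonzero
      [v_0 (x) w_0], and the difference of two curves of rank-one matrices with
      proportional leading terms is tangent to the rank-one matrices:
      [T_l = x_l (x) w_0 + v_0 (x) y_l] ([leading_tangent]).

    In the second case, let [J] be the set of [l] with [mu_l] nonzero. The sum
    of [a_l (x) T_l] over [J] is a restriction of [Str_q] with [q = #|J| + 1],
    and the remaining [a - #|J| = r - q] terms are of rank at most one. If [J]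
    had at most one element, its contribution would have rank at most
    [#|J| + 1], and [T] would again be a restriction of the unit tensor; hence
    [q >= 3]. *)

(** * Restrictions of the unit tensor and of Strassen's tensor *)

Section Restrictions.
Variable K : comNzRingType.

Lemma tensor_map_add a b c a' b' c' (A : 'M[K]_(a', a)) (B : 'M[K]_(b', b))
    (C : 'M[K]_(c', c)) (S T : tensor K a b c) :
  tensor_map A B C (S + T) = tensor_map A B C S + tensor_map A B C T.
Proof.
apply/ffunP => t; rewrite !ffunE -big_split; apply: eq_bigr => i _.
rewrite -big_split; apply: eq_bigr => j _.
rewrite -big_split; apply: eq_bigr => k _.
by rewrite ffunE mulrDr.
Qed.

Lemma tensor_map_sum n a b c a' b' c' (A : 'M[K]_(a', a)) (B : 'M[K]_(b', b))
    (C : 'M[K]_(c', c)) (F : 'I_n -> tensor K a b c) :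
  tensor_map A B C (\sum_(l < n) F l) = \sum_(l < n) tensor_map A B C (F l).
Proof.
apply: (big_morph _ (tensor_map_add A B C)); apply/ffunP => t; rewrite !ffunE.
rewrite big1 // => i _; rewrite big1 // => j _; rewrite big1 // => k _.
by rewrite ffunE mulr0.
Qed.

Lemma tensor_map_basis a b c a' b' c' (A : 'M[K]_(a', a)) (B : 'M[K]_(b', b))
    (C : 'M[K]_(c', c)) (i : 'I_a) (j : 'I_b) (k : 'I_c) t :
  tensor_map A B C
    (pure_tensor (basis_vec K a i) (basis_vec K b j) (basis_vec K c k)) t
  = A t.1.1 i * B t.1.2 j * C t.2 k.
Proof.
rewrite ffunE (bigD1 i) //= (bigD1 j) //= (bigD1 k) //= !ffunE !mxE !eqxx.
rewrite !mulr1 !big1 ?addr0 // => [i' /negPf ni | j' /negPf nj | k' /negPf nk].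
- rewrite big1 // => j' _; rewrite big1 // => k' _.
  by rewrite !ffunE !mxE /= -[_ == _ :> nat]/(i' == i) ni !mul0r mulr0.
- rewrite big1 // => k' _.
  by rewrite !ffunE !mxE /= -[j' == j :> nat]/(j' == j) nj mulr0 mul0r mulr0.
- by rewrite !ffunE !mxE /= -[k' == k :> nat]/(k' == k) nk !mulr0.
Qed.

Lemma tensor_map_unit r a b c (A : 'M[K]_(a, r)) (B : 'M[K]_(b, r))
    (C : 'M[K]_(c, r)) t :
  tensor_map A B C (unit_tensor K r) t
  = \sum_(l < r) A t.1.1 l * B t.1.2 l * C t.2 l.
Proof.
by rewrite tensor_map_sum sum_ffunE; apply: eq_bigr => l _; rewrite tensor_map_basis.
Qed.

Lemma tensor_map_strassen n a b c (A : 'M[K]_(a, n)) (B : 'M[K]_(b, n.+1))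
    (C : 'M[K]_(c, n.+1)) t :
  tensor_map A B C (strassen_tensor K n.+1) t
  = \sum_(l < n) A t.1.1 l *
      (B t.1.2 (widen_ord (leqnSn n) l) * C t.2 ord_max
       + B t.1.2 ord_max * C t.2 (widen_ord (leqnSn n) l)).
Proof.
rewrite tensor_map_sum sum_ffunE; apply: eq_bigr => l _.
have h1 := tensor_map_basis A B C l (widen_ord (leqnSn n) l) ord_max t.
have h2 := tensor_map_basis A B C l ord_max (widen_ord (leqnSn n) l) t.
by rewrite tensor_map_add ffunE mulrDr !mulrA -h1 -h2.
Qed.

Lemma restricts_unit_sum (I : finType) (A : {pred I}) a b c
    (T : tensor K a b c) (u : I -> 'I_a -> K) (v : I -> 'I_b -> K)
    (w : I -> 'I_c -> K) :
  (forall i j k, T (i, j, k) = \sum_(l in A) u l i * v l j * w l k) ->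
  restricts (unit_tensor K #|A|) T.
Proof.
move=> hT; exists (\matrix_(i, l) u (enum_val l) i).
exists (\matrix_(j, l) v (enum_val l) j), (\matrix_(k, l) w (enum_val l) k).
apply/ffunP => -[[i j] k]; rewrite hT tensor_map_unit big_enum_val.
by apply: eq_bigr => l _; rewrite !mxE.
Qed.

(** The distinguished basis vectors of [Str_(n+1)] go to [be] and [ga], the
    others to the [x l] and [y l]. *)
Lemma restricts_strassen_sum (I : finType) (A : {pred I}) a b c
    (T : tensor K a b c) (u : I -> 'I_a -> K) (x : I -> 'I_b -> K)
    (y : I -> 'I_c -> K) (be : 'I_b -> K) (ga : 'I_c -> K) :
  (forall i j k,
     T (i, j, k) = \sum_(l in A) u l i * (x l j * ga k + be j * y l k)) ->
  restricts (strassen_tensor K #|A|.+1) T.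
Proof.
move=> hT; exists (\matrix_(i, l) u (enum_val l) i).
exists (\matrix_(j, l) if unlift ord_max l is Some l' then x (enum_val l') j
                       else be j).
exists (\matrix_(k, l) if unlift ord_max l is Some l' then y (enum_val l') k
                       else ga k).
apply/ffunP => -[[i j] k]; rewrite hT tensor_map_strassen big_enum_val.
apply: eq_bigr => l _; rewrite !mxE unlift_none /=.
have -> : widen_ord (leqnSn #|A|) l = lift ord_max l.
  by apply: val_inj; rewrite /= /bump leqNgt ltn_ord.
by rewrite liftK.
Qed.

End Restrictions.

(** * Leading terms of rank-one matrices over [K[eps]] *)

Section LeadingTerms.
Variables (K : fieldType) (m n : nat).
Implicit Types (M W N : 'I_m -> 'I_n -> {poly K}).

Lemma minor_outer_product (b : 'I_m -> {poly K}) (c : 'I_n -> {poly K}) d W :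
  (forall j k, b j * c k = 'X^d * W j k) ->
  forall j k j' k', W j k * W j' k' = W j k' * W j' k.
Proof.
move=> hW j k j' k'.
have Xn0 : 'X^d != 0 :> {poly K} by rewrite monic_neq0 ?monicXn.
apply: (mulfI Xn0); apply: (mulfI Xn0).
rewrite [LHS](_ : _ = ('X^d * W j k) * ('X^d * W j' k')); last by ring.
rewrite [RHS](_ : _ = ('X^d * W j k') * ('X^d * W j' k)); last by ring.
by rewrite -!hW; ring.
Qed.

(** A matrix whose [2 x 2] minors vanish is the product of one of its columns
    and one of its rows, up to the entry where they cross; so matrices of rank
    at most one are closed under taking leading terms in [eps]. *)
Lemma leading_outer_product (b : 'I_m -> {poly K}) (c : 'I_n -> {poly K}) d W :
  (forall j k, b j * c k = 'X^d * W j k) ->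
  exists (x : 'I_m -> K) (y : 'I_n -> K),
    forall j k, (W j k).[0] = x j * y k.
Proof.
move=> /minor_outer_product hW.
case: (pickP (fun t : 'I_m * 'I_n => (W t.1 t.2).[0] != 0)) => [[j0 k0] /= n0|W0].
  exists (fun j => (W j k0).[0]), (fun k => (W j0 k).[0] / (W j0 k0).[0]).
  move=> j k; apply: (mulIf n0); rewrite mulrA divfK //.
  by have := congr1 (horner^~ 0) (hW j k j0 k0); rewrite /= !hornerM.
exists (fun=> 0), (fun=> 0) => j k; rewrite mul0r.
by apply/eqP; move: (W0 (j, k)) => /= /negbFE.
Qed.

(** If a rank-one matrix is, up to a power of [eps], [mu M + eps^(e+1) N], where [M] is a rank-one
    matrix with [M(0) = be (x) ga] nonzero, then [N(0)] is tangent at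
    [be (x) ga] to the matrices of rank one. Indeed, in the difference of the
    [2 x 2] minors of the two rank-one matrices, the lowest term in [eps] is
    the polarization of the minor at [M(0)] and [N(0)], which must vanish; the
    minors through an entry where [be (x) ga] is nonzero then determine
    [N(0)]. *)
Lemma leading_tangent (b : 'I_m -> {poly K}) (c : 'I_n -> {poly K}) s e
    (mu : K) M N (be : 'I_m -> K) (ga : 'I_n -> K) j0 k0 :
  mu != 0 ->
  (forall j k j' k', M j k * M j' k' = M j k' * M j' k) ->
  (forall j k, (M j k).[0] = be j * ga k) ->
  be j0 * ga k0 != 0 ->
  (forall j k, b j * c k = 'X^s * (mu%:P * M j k + 'X^(e.+1) * N j k)) ->
  exists (x : 'I_m -> K) (y : 'I_n -> K),
    forall j k, (N j k).[0] = x j * ga k + be j * y k.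
Proof.
move=> mu0 minM M0; rewrite mulf_eq0 => /norP[be0 ga0] /minor_outer_product minP.
pose t j k := (N j k).[0].
exists (fun j => t j k0 / ga k0).
exists (fun k => t j0 k / be j0 - t j0 k0 * ga k / (be j0 * ga k0)) => j k.
have Xn0 : 'X^(e.+1) != 0 :> {poly K} by rewrite monic_neq0 ?monicXn.
have polar : mu%:P * (M j0 k0 * N j k + N j0 k0 * M j k
                      - M j0 k * N j k0 - N j0 k * M j k0)
             + 'X^(e.+1) * (N j0 k0 * N j k - N j0 k * N j k0) = 0.
  apply: (mulfI Xn0); rewrite mulr0.
  (* The left side is the minor of [mu M + eps^(e+1) N] minus [mu^2] times that
     of [M]. *)
  have h1 := minP j0 k0 j k; have h2 := minM j0 k0 j k.
  move/eqP: h1; rewrite -subr_eq0 => /eqP h1.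
  move/eqP: h2; rewrite -subr_eq0 => /eqP h2.
  rewrite -[RHS]h1 -[LHS]addr0 -[X in _ + X = _](mulr0 (mu%:P * mu%:P)) -h2.
  by ring.
have {polar} := congr1 (horner^~ 0) polar.
rewrite !(hornerE, M0) !expr0n /= mul0r addr0 => /eqP.
rewrite -/(t j k) -/(t j0 k0) -/(t j k0) -/(t j0 k) mulf_eq0 (negPf mu0) /= => /eqP h.
have bg0 : be j0 * ga k0 != 0 by rewrite mulf_neq0.
apply: (mulfI bg0); apply/eqP; rewrite -subr_eq0 -[X in _ == X]h; apply/eqP.
by field; rewrite be0 ga0.
Qed.

(** As long as all constant terms vanish, a further factor [eps] can be taken
    out of the whole family; this stops at its order of vanishing, or at
    [d]. *)
Lemma exists_order (M : 'I_m -> 'I_n -> {poly K}) d :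
  (exists W, forall j k, M j k = 'X^d * W j k) \/
  exists s W, [/\ (s < d)%N, (forall j k, M j k = 'X^s * W j k)
                 & exists j k, (W j k).[0] != 0].
Proof.
elim: d => [|d [[W hW]|[s [W [lt_sd hW nz]]]]].
- by left; exists M => j k; rewrite mul1r.
- case: (pickP (fun t : 'I_m * 'I_n => (W t.1 t.2).[0] != 0)) => [[j k] /= nz|W0].
    by right; exists d, W; split=> //; exists j, k.
  left; exists (fun j k => W j k %/ 'X) => j k.
  rewrite hW exprSr -mulrA ['X * _]mulrC divpK // -['X]subr0 dvdp_XsubCl.
  by move: (W0 (j, k)) => /= /negbFE.
- by right; exists s, W; split=> //; apply: ltnW.
Qed.

End LeadingTerms.

(** * Partial degenerations of the unit tensor *)

Section Classification.
Variable K : fieldType.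

Lemma partially_degenerates_unit r a b c (T : tensor K a b c) :
  partially_degenerates (unit_tensor K r) T ->
  exists (A : 'M[K]_(a, r)) (B : 'M[{poly K}]_(b, r)) (C : 'M[{poly K}]_(c, r))
         (d : nat) (N : 'I_a -> 'I_b -> 'I_c -> {poly K}),
    (forall i j k,
       \sum_(l < r) (A i l)%:P * B j l * C k l = 'X^d * N i j k) /\
    (forall i j k, (N i j k).[0] = T (i, j, k)).
Proof.
case=> A [B [C [d [e [S_ hT]]]]]; exists A, B, C, d.
exists (fun i j k => (T (i, j, k))%:P
          + \sum_(l < e) 'X^(l.+1) * (S_ l (i, j, k))%:P); split=> i j k.
  have := congr1 (fun F : tensor {poly K} a b c => F (i, j, k)) hT.
  have -> : tensorC (unit_tensor K r) = unit_tensor {poly K} r.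
    apply/ffunP => t; rewrite /unit_tensor ffunE !sum_ffunE rmorph_sum /=.
    by apply: eq_bigr => l _; rewrite !ffunE !mxE !rmorphM !rmorph_nat.
  rewrite tensor_map_unit [RHS]ffunE ffunE mulrDr mulr_sumr => h.
  transitivity (\sum_(l < r) map_mx polyC A i l * B j l * C k l).
    by apply: eq_bigr => l _; rewrite mxE.
  rewrite h; congr (_ + _); apply: eq_bigr => l _.
  by rewrite ffunE mulrA -exprD.
rewrite hornerD hornerC horner_sum big1 ?addr0 // => l _.
by rewrite hornerM hornerXn expr0n mul0r.
Qed.

(** A linear form vanishing on all the constant first factors kills the whole
    degeneration, hence also its leading term [T]. *)
Lemma row_free_first_factor r a b c (T : tensor K a b c) (A : 'M[K]_(a, r))
    (B : 'M[{poly K}]_(b, r)) (C : 'M[{poly K}]_(c, r)) d N :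
  injective (flattening1 T) ->
  (forall i j k, \sum_(l < r) (A i l)%:P * B j l * C k l = 'X^d * N i j k) ->
  (forall i j k, (N i j k).[0] = T (i, j, k)) ->
  row_free A.
Proof.
move=> injT hN hT; apply: inj_row_free => v vA0; apply: injT.
apply/matrixP => j k; rewrite !mxE [RHS]big1 => [|i _]; last by rewrite mxE mul0r.
have Xn0 : 'X^d != 0 :> {poly K} by rewrite monic_neq0 ?monicXn.
suff h : \sum_i (v 0 i)%:P * N i j k = 0.
  have := congr1 (horner^~ 0) h; rewrite /= horner0 horner_sum => h0.
  by rewrite -[RHS]h0; apply: eq_bigr => i _; rewrite hornerM hornerC hT.
apply: (mulfI Xn0); rewrite mulr0 mulr_sumr.
under eq_bigr => i _ do rewrite mulrCA -hN mulr_sumr.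
rewrite exchange_big big1 // => l _.
have := congr1 (fun M : 'rV[K]_r => (M 0 l)%:P) vA0; rewrite !mxE polyC0 rmorph_sum /= => h.
rewrite -[RHS](mul0r (B j l * C k l)) -[in RHS]h mulr_suml.
by apply: eq_bigr => i _; rewrite rmorphM !mulrA.
Qed.

(** A nonzero linear relation between the columns of [A] allows any column
    that occurs in it to be dropped without loss of rank. *)
Lemma exists_unit_col' n (A : 'M[K]_(n, n.+1)) :
  row_free A -> exists l0, col' l0 A \in unitmx.
Proof.
move=> fA.
have /rowV0Pn[la /sub_kermxP laA nz_la] : kermx A^T != 0.
  rewrite -mxrank_eq0 mxrank_ker mxrank_tr (eqP fA) subSnn //.
have [l0 nz0] : exists l0, la 0 l0 != 0.
  by apply/existsP; apply: contraNT nz_la => /existsPn h; apply/eqP/rowP => l;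
     rewrite mxE; apply/eqP; move: (h l); rewrite negbK.
exists l0; rewrite -row_free_unit; apply: inj_row_free => v v0.
have vA l : (v *m A) 0 (lift l0 l) = 0.
  have := congr1 (fun M : 'rV[K]_n => M 0 l) v0; rewrite !mxE => h.
  by rewrite -[RHS]h; apply: eq_bigr => i _; rewrite mxE.
have vA0 : (v *m A) 0 l0 = 0.
  have h : v *m A *m la^T = 0.
    by apply: trmx_inj; rewrite -mulmxA !trmx_mul trmxK laA mul0mx trmx0.
  move/(congr1 (fun M : 'M[K]_1 => M 0 0)): h; rewrite [X in X = _ -> _]mxE [X in _ = X -> _]mxE.
  rewrite (bigD1_ord l0) //= big1 => [|l _]; last by rewrite vA mul0r.
  by rewrite addr0 [la^T _ _]mxE => /eqP; rewrite mulf_eq0 (negPf nz0) orbF => /eqP.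
apply: (row_free_inj fA); rewrite mul0mx; apply/rowP => l; rewrite [RHS]mxE.
by case: (unliftP l0 l) => [l'|] ->.
Qed.

(** Since the first factors are constant and span, [a] of the [a + 1] rank-one
    terms have independent first factors; in the corresponding basis every
    slice of [T] is a leading term of a combination of only two rank-one
    matrices, one of them common to all slices. *)
Lemma partially_degenerates_slices a b c (T : tensor K a b c) :
  injective (flattening1 T) -> partially_degenerates (unit_tensor K a.+1) T ->
  exists (u : 'I_a -> 'I_a -> K) (mu : 'I_a -> K)
         (be : 'I_a -> 'I_b -> {poly K}) (ga : 'I_a -> 'I_c -> {poly K})
         (be0 : 'I_b -> {poly K}) (ga0 : 'I_c -> {poly K}) (d : nat)
         (N : 'I_a -> 'I_b -> 'I_c -> {poly K}),
    (forall l j k,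
       be l j * ga l k = 'X^d * N l j k + (mu l)%:P * (be0 j * ga0 k)) /\
    (forall i j k, T (i, j, k) = \sum_l u l i * (N l j k).[0]).
Proof.
move=> injT /partially_degenerates_unit[A [B [C [d [N [hN hT]]]]]].
have [l0 uP] := exists_unit_col' (row_free_first_factor injT hN hT).
set P := col' l0 A in uP; pose Q := invmx P.
exists (fun l i => P i l), (fun l => - (Q *m A) l l0).
exists (fun l j => B j (lift l0 l)), (fun l k => C k (lift l0 l)).
exists (fun j => B j l0), (fun k => C k l0), d.
exists (fun l j k => \sum_i (Q l i)%:P * N i j k); split.
  move=> l j k; rewrite mulr_sumr.
  under eq_bigr => i _ do rewrite mulrCA -hN mulr_sumr.
  rewrite exchange_big /=.
  have QA l' : \sum_i (Q l i)%:P * ((A i l')%:P * B j l' * C k l')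
               = ((Q *m A) l l')%:P * (B j l' * C k l').
    rewrite mxE rmorph_sum mulr_suml; apply: eq_bigr => i _.
    by rewrite rmorphM !mulrA.
  under eq_bigr => l' _ do rewrite QA.
  rewrite (bigD1_ord l0) //= (bigD1 l) //= big1 => [|l' nl].
    have -> : (Q *m A) l (lift l0 l) = 1.
      have := congr1 (fun M : 'M[K]_a => M l l) (mulVmx uP); rewrite !mxE eqxx => h.
      by rewrite -[RHS]h; apply: eq_bigr => i _; rewrite !mxE.
    by rewrite rmorphN /=; ring.
  have -> : (Q *m A) l (lift l0 l') = 0.
    have := congr1 (fun M : 'M[K]_a => M l l') (mulVmx uP).
    rewrite !mxE eq_sym (negPf nl) => h.
    by rewrite -[RHS]h; apply: eq_bigr => i _; rewrite !mxE.
  by rewrite mul0r.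
move=> i j k.
under eq_bigr => l _ do rewrite horner_sum mulr_sumr.
rewrite exchange_big /= (bigD1 i) //= [X in _ + X]big1 => [|i' ni].
  under eq_bigr => l _ do rewrite hornerM hornerC mulrA hT.
  rewrite -mulr_suml addr0.
  have := congr1 (fun M : 'M[K]_a => M i i) (mulmxV uP); rewrite !mxE eqxx => ->.
  by rewrite mul1r.
under eq_bigr => l _ do rewrite hornerM hornerC mulrA.
rewrite -mulr_suml.
have := congr1 (fun M : 'M[K]_a => M i i') (mulmxV uP).
by rewrite !mxE eq_sym (negPf ni) => ->; rewrite mul0r.
Qed.

(** For [T] with slices of rank one up to a single further pure tensor. *)
Lemma restricts_unit_succ a b c (T : tensor K a b c) (u : 'I_a -> 'I_a -> K)
    (v : 'I_a -> 'I_b -> K) (w : 'I_a -> 'I_c -> K) u0 v0 w0 :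
  (forall i j k,
     T (i, j, k) = \sum_l u l i * v l j * w l k + u0 i * v0 j * w0 k) ->
  restricts (unit_tensor K a.+1) T.
Proof.
move=> hT.
have <- : #|'I_a.+1| = a.+1 by apply: card_ord.
pose ext n (f : 'I_a -> 'I_n -> K) f0 l :=
  if unlift ord0 l is Some l' then f l' else f0.
apply: (@restricts_unit_sum _ _ _ _ _ _ _ (ext a u u0) (ext b v v0) (ext c w w0)).
move=> i j k; rewrite big_ord_recl /ext unlift_none hT addrC.
by congr (_ + _); apply: eq_bigr => l _; rewrite liftK.
Qed.

(** The alternative is whether or not the product [be0 (x) ga0] common to all
    slices vanishes to order [d]: if it does, everything can be divided by
    [eps^d]; if not, the slices with [mu l != 0] are tangent at its leading
    term [v0 (x) w0]. *)
Lemma slices_classification a b c (T : tensor K a b c)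
    (u : 'I_a -> 'I_a -> K) (mu : 'I_a -> K)
    (be : 'I_a -> 'I_b -> {poly K}) (ga : 'I_a -> 'I_c -> {poly K})
    (be0 : 'I_b -> {poly K}) (ga0 : 'I_c -> {poly K}) (d : nat)
    (N : 'I_a -> 'I_b -> 'I_c -> {poly K}) :
  (forall l j k,
     be l j * ga l k = 'X^d * N l j k + (mu l)%:P * (be0 j * ga0 k)) ->
  (forall i j k, T (i, j, k) = \sum_l u l i * (N l j k).[0]) ->
  restricts (unit_tensor K a.+1) T \/
  exists (v : 'I_a -> 'I_b -> K) (w : 'I_a -> 'I_c -> K) (v0 : 'I_b -> K)
         (w0 : 'I_c -> K),
    forall i j k, T (i, j, k) =
      \sum_(l | mu l != 0) u l i * (v l j * w0 k + v0 j * w l k)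
      + \sum_(l | mu l == 0) u l i * v l j * w l k.
Proof.
move=> hN hT.
case: (exists_order (fun j k => be0 j * ga0 k) d) => [[W hW]|[s [W [lt_sd hW [j0 [k0 nz]]]]]].
  left; have [v0 [w0 h0]] := leading_outer_product hW.
  have /fin_all_exists[v /fin_all_exists[w hvw]] l : exists v w, forall j k,
      (N l j k).[0] + mu l * (W j k).[0] = v j * w k.
    have := @leading_outer_product _ _ _ (be l) (ga l) d
      (fun j k => N l j k + (mu l)%:P * W j k).
    case=> [j k|v [w hvw]]; first by rewrite hN hW; ring.
    by exists v, w => j k; rewrite -hvw !hornerE.
  apply: (@restricts_unit_succ _ _ _ _ u v w
            (fun i => - \sum_l u l i * mu l) v0 w0) => i j k.
  rewrite hT -mulrA -h0 mulNr mulr_suml -sumrB; apply: eq_bigr => l _.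
  by rewrite -[u l i * v l j * _]mulrA -hvw; ring.
right; have [v0 [w0 h0]] := leading_outer_product hW.
have /fin_all_exists[v /fin_all_exists[w hvw]] l : exists v w, forall j k,
    (N l j k).[0] = if mu l == 0 then v j * w k else v j * w0 k + v0 j * w k.
  have [mul0|nz_mu] := eqVneq (mu l) 0.
    apply: (@leading_outer_product _ _ _ (be l) (ga l) d) => j k.
    by rewrite hN mul0 mul0r addr0.
  apply: (@leading_tangent _ _ _ (be l) (ga l) s (d - s.+1) (mu l) W (N l)
            v0 w0 j0 k0) => //.
  - exact: minor_outer_product hW.
  - by rewrite -h0.
  by move=> j k; rewrite hN hW subnSK // -[in LHS](subnKC (ltnW lt_sd)) exprD; ring.
exists v, w, v0, w0 => i j k; rewrite hT (bigID (fun l => mu l != 0)) /=.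
congr (_ + _); first by apply: eq_bigr => l /negPf nz_mu; rewrite hvw nz_mu.
by apply: eq_big => l; rewrite negbK // => mul0; rewrite hvw mul0 mulrA.
Qed.

Lemma partial_degeneration_classification a b c (T : tensor K a b c) :
  injective (flattening1 T) ->
  partially_degenerates (unit_tensor K a.+1) T ->
  ~ restricts (unit_tensor K a.+1) T ->
  exists q : nat, (3 <= q <= a.+1)%N /\
    exists S X : tensor K a b c,
      [/\ T = S + X, restricts (strassen_tensor K q) S
        & restricts (unit_tensor K (a.+1 - q)) X].
Proof.
move=> injT /(partially_degenerates_slices injT).
move=> [u [mu [be [ga [be0 [ga0 [d [N [hN hT]]]]]]]]] nres.
have [//|[v [w [v0 [w0 {}hT]]]]] := slices_classification hN hT.
pose J := [pred l | mu l != 0]; exists #|J|.+1.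
have cardJ : (#|J| + #|[predC J]| = a)%N by rewrite cardC card_ord.
split.
  rewrite !ltnS -[X in (#|J| <= X)%N]cardJ leq_addr andbT ltnNge.
  apply/negP => J1; apply: nres.
  (* The sum over [J] has at most one term, so its second half is the pure
     tensor whose factors are the sums of the factors over [J]. *)
  apply: (@restricts_unit_succ _ _ _ _ u v (fun l => if mu l == 0 then w l else w0)
            (fun i => \sum_(l in J) u l i) v0 (fun k => \sum_(l in J) w l k)).
  move=> i j k; rewrite hT [X in _ = X + _](bigID (fun l => mu l != 0)) /=.
  rewrite addrAC; congr (_ + _); last first.
    by apply: eq_big => l; [rewrite negbK | move=> ->].
  have -> : (\sum_(l in J) u l i) * v0 j * (\sum_(l in J) w l k)
            = \sum_(l in J) u l i * (v0 j * w l k).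
    rewrite -mulrA mulr_suml; apply: eq_bigr => l lJ; rewrite mulr_sumr.
    rewrite (bigD1 l) //= big1 ?addr0 // => l' /andP[l'J].
    by rewrite (card_le1_eqP J1 l l' lJ l'J) eqxx.
  rewrite -big_split; apply: eq_bigr => l /negPf nz_mu.
  by rewrite nz_mu mulrDr mulrA.
exists [ffun t => \sum_(l in J) u l t.1.1 * (v l t.1.2 * w0 t.2 + v0 t.1.2 * w l t.2)].
exists [ffun t => \sum_(l in [predC J]) u l t.1.1 * v l t.1.2 * w l t.2].
split.
- apply/ffunP => -[[i j] k]; rewrite !ffunE hT; congr (_ + _).
  by apply: eq_bigl => l; rewrite !inE negbK.
- by apply: (restricts_strassen_sum (u := u) (x := v) (y := w)) => i j k; rewrite ffunE.
- rewrite subSS -[X in (X - _)%N]cardJ addKn.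
  by apply: (restricts_unit_sum (u := u) (v := v) (w := w)) => i j k; rewrite ffunE.
Qed.

End Classification.

Theorem proposition3p16 (R : realType) (r a b c : nat) (ha : (a + 1 = r)%N)
    (T : tensor R[i] a b c) (hconcise : concise T)
    (hdeg : partially_degenerates (unit_tensor R[i] r) T)
    (hnres : ~ restricts (unit_tensor R[i] r) T) :
  exists q : nat, (3 <= q <= r)%N /\
    exists S X : tensor R[i] a b c,
      [/\ T = S + X,
          restricts (strassen_tensor R[i] q) S
        & restricts (unit_tensor R[i] (r - q)) X].
Proof.
move: hdeg hnres; rewrite -{}ha addn1; case: hconcise => injT _ _.
exact: partial_degeneration_classification.
Qed.
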